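(* Let $X$ be a compact Hausdorff space and $\mathcal{F}\le\mathcal{E}$ an embedding of (F) Banach bundles over $X$ (a subbundle). For $r>0$ consider the map $$X\ni x\longmapsto (\mathcal{F}_x)_{\le r}:=\{s\in\mathcal{F}_x : \|s\|\le r\}\in\mathrm{Cl}(\mathcal{E}):=\{\text{closed subsets of }\mathcal{E}\}.$$ This map is continuous for the upper Vietoris topology on $\mathrm{Cl}(\mathcal{E})$ for some $r>0$ if and only if it is so for all $r>0$; and if this is the case, then the quotient bundle $\mathcal{E}/\mathcal{F}$ is again (F).
   Context: An (H) Banach bundle over $X$ is a continuous open surjection $\pi:\mathcal{E}\to X$ whose fibers $\mathcal{E}_x:=\pi^{-1}(x)$ are complex Banach spaces, such that: scalar multiplication and fiberwise addition are continuous; the norm $\mathcal{E}\to\mathbb{R}$ is upper semicontinuous; and for every $x\in X$ the sets $\{s\in\mathcal{E} : \pi(s)\in U,\ \|s\|<\varepsilon\}$ ($U$ a neighborhood of $x$, $\varepsilon>0$) form a fundamental system of neighborhoods of $0_x\in\mathcal{E}_x$. It is (F), or continuous, if moreover the norm is continuous. A subbundle $\mathcal{F}\le\mathcal{E}$ is a family of closed subspaces $\mathcal{F}_x\le\mathcal{E}_x$, $x\in X$, whose union is an (H) Banach bundle with the topology and projection inherited from $\mathcal{E}$. The quotient bundle is $\mathcal{E}/\mathcal{F}:=\coprod_{x\in X}\mathcal{E}_x/\mathcal{F}_x$ with the quotient topology and the quotient norms on fibers; it is always an (H) Banach bundle. The upper Vietoris topology on a class of subsets $A$ of a topological space $Z$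 has as (sub)base the collections $\{A : A\subset W\}$ with $W\subseteq Z$ open. *)

(* Defs.v *)
From HB Require Import structures.
From mathcomp Require Import all_boot all_order all_algebra.
From mathcomp Require Import generic_quotient ring_quotient complex.
From mathcomp Require Import all_classical all_reals all_analysis.
Import Order.TTheory GRing.Theory Num.Theory.
Import numFieldNormedType.Exports.
Set Implicit Arguments.
Unset Strict Implicit.
Unset Printing Implicit Defensive.
Local Open Scope classical_set_scope.
Local Open Scope ring_scope.

(* The complex numbers, declared as a [numFieldType] since [R[i]] itself has no
   canonical topology. *)
Definition Cplx (R : realType) : numFieldType := R[i].

(* Norms of normed modules over [Cplx R] are [Cplx R]-valued; this is the same
   norm with values in [R]. *)
Definition rnorm (R : realType) (V : normedModType (Cplx R)) (v : V) : R :=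
  complex.Re (`|v| : R[i]).

Section Rnorm.
Context {R : realType}.
Local Open Scope complex_scope.

Lemma lecR_Cplx (a b : R) : ((a%:C : Cplx R) <= b%:C) = (a <= b).
Proof.
by rewrite /Order.le/= eqxx.
Qed.

Lemma ltcR_Cplx (a b : R) : ((a%:C : Cplx R) < b%:C) = (a < b).
Proof. by rewrite /Order.lt/= eqxx. Qed.

Lemma gt0_Cplx (e : Cplx R) : 0 < e -> exists2 r : R, 0 < r & e = r%:C.
Proof.
case: e => a b; rewrite /Order.lt/= => /andP[/eqP b0 a0].
by exists a => //; rewrite b0.
Qed.

Lemma normCplxR (a : R) : 0 <= a -> `|a%:C : Cplx R| = a%:C.
Proof. by move=> a0; rewrite ger0_norm// lecR_Cplx. Qed.

Lemma addCplxR (a b : R) : (a%:C : Cplx R) + b%:C = (a + b)%:C.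
Proof. by congr Complex; rewrite ?addr0. Qed.

Lemma mulCplxR (a b : R) : (a%:C : Cplx R) * b%:C = (a * b)%:C.
Proof. by congr Complex; rewrite ?mulr0 ?mul0r ?addr0 ?subr0. Qed.

Section V.
Variable V : normedModType (Cplx R).
Implicit Types u v : V.

Lemma rnormE v : `|v| = (rnorm v)%:C.
Proof.
have: 0 <= `|v| by exact: normr_ge0.
rewrite /rnorm; case: (`|v|) => a b; rewrite /Order.le/= => /andP[/eqP -> _].
by [].
Qed.

Lemma rnorm_ge0 v : 0 <= rnorm v.
Proof. by rewrite -lecR_Cplx -rnormE; exact: normr_ge0. Qed.

Lemma rnorm0 : rnorm (0 : V) = 0.
Proof. by rewrite /rnorm normr0. Qed.

Lemma rnorm_eq0 v : rnorm v = 0 -> v = 0.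
Proof. by move=> v0; apply/eqP; rewrite -normr_eq0 rnormE v0. Qed.

Lemma rnormD u v : rnorm (u + v) <= rnorm u + rnorm v.
Proof. by rewrite -lecR_Cplx -addCplxR -!rnormE ler_normD. Qed.

Lemma rnormN v : rnorm (- v) = rnorm v.
Proof. by rewrite /rnorm normrN. Qed.

Lemma rnormB u v : rnorm (u - v) = rnorm (v - u).
Proof. by rewrite -rnormN opprB. Qed.

Lemma rnormZ (l : Cplx R) v :
  rnorm (l *: v) = complex.Re (`|l| : R[i]) * rnorm v.
Proof.
rewrite {1}/rnorm normrZ rnormE.
have: 0 <= `|l| by exact: normr_ge0.
case: (`|l|) => a b; rewrite /Order.le/= => /andP[/eqP -> _].
change (complex.Re ((a%:C : Cplx R) * (rnorm v)%:C) = a * rnorm v).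
by rewrite mulCplxR.
Qed.

End V.
End Rnorm.

Lemma nbhs_rnormP (R : realType) (V : normedModType (Cplx R)) (v : V)
    (A : set V) :
  nbhs v A <-> exists2 e : R, 0 < e & [set w | rnorm (v - w) < e] `<=` A.
Proof.
rewrite -nbhs_ballE; split => [[e /gt0_Cplx[r r0 ->]]|[e e0 eA]].
  move=> rA; exists r => // w /= vw; apply: rA; rewrite -ball_normE/=.
  by rewrite rnormE ltcR_Cplx.
exists (e%:C%C); first by rewrite /= (ltcR_Cplx 0).
by move=> w; rewrite -ball_normE/= rnormE ltcR_Cplx; exact: eA.
Qed.

Lemma cauchy_rnormP (R : realType) (V : normedModType (Cplx R))
    (F : set_system V) : ProperFilter F ->
  cauchy F <-> forall e : R, 0 < e -> exists v, F [set w | rnorm (v - w) < e].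
Proof.
move=> PF; rewrite cauchyP; split=> [cF e e0|cF e /gt0_Cplx[r r0 ->]].
  have [|v Fv] := cF (e%:C%C); first by rewrite (ltcR_Cplx 0).
  exists v; apply: filterS Fv => w; rewrite -ball_normE/= rnormE.
  by rewrite ltcR_Cplx.
have [v Fv] := cF r r0; exists v; apply: filterS Fv => w /=.
by rewrite -ball_normE/= rnormE ltcR_Cplx.
Qed.

Record closed_subspace (R : realType) (V : normedModType (Cplx R)) :=
  ClosedSubspace {
    cs_mem :> {pred V};
    cs_submod : submod_closed cs_mem;
    cs_closed : closed [set v | v \in cs_mem] }.

HB.instance Definition _ R V (W : @closed_subspace R V) :=
  GRing.isSubmodClosed.Build (Cplx R) V (cs_mem W) (cs_submod W).

(* The subspace W as a Banach space, with the norm of V. *)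
Definition subsp R V (W : @closed_subspace R V) := {v : V | v \in cs_mem W}.

HB.instance Definition _ R V (W : @closed_subspace R V) :=
  SubChoice.on (subsp W).
HB.instance Definition _ R V (W : @closed_subspace R V) :=
  [SubChoice_isSubZmodule of subsp W by <:].
HB.instance Definition _ R V (W : @closed_subspace R V) :=
  [SubZmodule_isSubLmodule of subsp W by <:].

Section ClosedSubspaceBanach.
Context {R : realType} (V : completeNormedModType (Cplx R)).
Variable W : closed_subspace V.

Definition subsp_norm (w : subsp W) : Cplx R := `|val w|.

Let subsp_normD w1 w2 :
  subsp_norm (w1 + w2) <= subsp_norm w1 + subsp_norm w2.
Proof. exact: ler_normD. Qed.

Let subsp_normZ (l : Cplx R) w : subsp_norm (l *: w) = `|l| * subsp_norm w.
Proof. exact: normrZ. Qed.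

Let subsp_norm_eq0 w : subsp_norm w = 0 -> w = 0.
Proof. by move=> /normr0_eq0 w0; apply: val_inj; rewrite w0. Qed.

HB.instance Definition _ := Lmodule_isNormed.Build (Cplx R) (subsp W)
  subsp_normD subsp_normZ subsp_norm_eq0.

Lemma rnorm_subsp (w : subsp W) : rnorm w = rnorm (val w).
Proof. by []. Qed.

Let subsp_cauchy_cvg (F : set_system (subsp W)) :
  ProperFilter F -> cauchy F -> cvg F.
Proof.
move=> PF /cauchy_rnormP cF.
have /cauchy_cvg Gcvg : cauchy ((val : subsp W -> V) @ F).
  apply/cauchy_rnormP => e e0; have [w Fw] := cF e e0.
  by exists (val w); exact: Fw.
set l := lim ((val : subsp W -> V) @ F) in Gcvg.
have Wl : l \in cs_mem W.
  apply: (closed_cvg _ (@cs_closed _ _ W) _ l Gcvg).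
  by apply: nearW => w /=; exact: (valP w).
apply/cvg_ex; exists (exist _ l Wl) => A /nbhs_rnormP[e e0 eA].
have /Gcvg lF : nbhs l [set v | rnorm (l - v) < e].
  by apply/nbhs_rnormP; exists e.
by apply: (@filterS _ F _ [set w | rnorm (l - val w) < e]).
Qed.

HB.instance Definition _ :=
  Uniform_isComplete.Build (subsp W) subsp_cauchy_cvg.

End ClosedSubspaceBanach.

(* The quotient V / W, with the norm of a coset the infimum of the norms of its
   representatives, cf. [quot_rnorm]. *)
Definition quotsp R V (W : @closed_subspace R V) := Quotient.quot (cs_mem W).

HB.instance Definition _ R V (W : @closed_subspace R V) :=
  GRing.Zmodule.on (quotsp W).
HB.instance Definition _ R V (W : @closed_subspace R V) :=
  EqQuotient.on (quotsp W).

Definition coset R V (W : @closed_subspace R V) (v : V) : quotsp W :=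
  (\pi_(quotsp W) v)%qT.

Section QuotientBanach.
Context {R : realType} (V : completeNormedModType (Cplx R)).
Variable W : closed_subspace V.
Local Notation Q := (quotsp W).
Implicit Types (u v w : V) (p q : Q).

Lemma cosetP v w : reflect (coset W v = coset W w) (v - w \in cs_mem W).
Proof. by rewrite (Quotient.idealrBE (cs_mem W)); exact: eqP. Qed.

Lemma coset_ind (P : Q -> Prop) : (forall v, P (coset W v)) -> forall q, P q.
Proof. by move=> Pc q; rewrite -[q]reprK; exact: Pc. Qed.

Lemma cosetD u v : coset W (u + v) = coset W u + coset W v.
Proof. exact: (Quotient.pi_add (cs_mem W)). Qed.

Lemma cosetN v : coset W (- v) = - coset W v.
Proof. exact: (Quotient.pi_opp (cs_mem W)). Qed.

Lemma cosetB u v : coset W (u - v) = coset W u - coset W v.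
Proof. by rewrite cosetD cosetN. Qed.

Lemma coset0 : coset W 0 = 0.
Proof. by rewrite -(subrr 0) cosetB subrr. Qed.

Definition quot_scale (a : Cplx R) q : Q := coset W (a *: repr q).

Lemma coset_scale a v : quot_scale a (coset W v) = coset W (a *: v).
Proof.
apply/cosetP; rewrite -scalerBr rpredZ//; apply/cosetP.
by rewrite /coset reprK.
Qed.

Let quot_scalerA a b q : quot_scale a (quot_scale b q) = quot_scale (a * b) q.
Proof. by elim/coset_ind: q => v; rewrite !coset_scale scalerA. Qed.

Let quot_scale1r : left_id 1 quot_scale.
Proof. by elim/coset_ind => v; rewrite coset_scale scale1r. Qed.

Let quot_scalerDr : right_distributive quot_scale +%R.
Proof.
move=> a; elim/coset_ind => u; elim/coset_ind => v.
by rewrite -cosetD !coset_scale scalerDr cosetD.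
Qed.

Let quot_scalerDl q : {morph quot_scale^~ q : a b / a + b}.
Proof.
by move=> a b; elim/coset_ind: q => v; rewrite !coset_scale scalerDl cosetD.
Qed.

HB.instance Definition _ := GRing.Zmodule_isLmodule.Build (Cplx R) Q
  quot_scalerA quot_scale1r quot_scalerDr quot_scalerDl.

Lemma cosetZ a v : coset W (a *: v) = a *: coset W v.
Proof. by rewrite -coset_scale. Qed.

Definition quot_rnorm q : R := inf [set rnorm v | v in [set v | coset W v = q]].

Let quot_lbound q : lbound [set rnorm v | v in [set v | coset W v = q]] 0.
Proof. by move=> _ [v _ <-]; exact: rnorm_ge0. Qed.

Lemma quot_rnorm_le v : quot_rnorm (coset W v) <= rnorm v.
Proof.
by apply: ge_inf; [exists 0; exact: quot_lbound|exists v].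
Qed.

Lemma quot_rnorm_lt q e : quot_rnorm q < e ->
  exists2 v, coset W v = q & rnorm v < e.
Proof.
move=> /(inf_lt _)[|_ [v vq <-] ve]; last by exists v.
by elim/coset_ind: q => v; exists (rnorm v); exists v.
Qed.

Lemma quot_rnorm_ge0 q : 0 <= quot_rnorm q.
Proof.
apply: lb_le_inf; last exact: quot_lbound.
by elim/coset_ind: q => v; exists (rnorm v); exists v.
Qed.

Lemma quot_rnormD p q : quot_rnorm (p + q) <= quot_rnorm p + quot_rnorm q.
Proof.
apply/ler_addgt0Pr => e e0; have e20 : 0 < e / 2 by rewrite divr_gt0.
have [u <- ue] : exists2 u, coset W u = p & rnorm u < quot_rnorm p + e / 2.
  by apply: quot_rnorm_lt; rewrite ltrDl.
have [v <- ve] : exists2 v, coset W v = q & rnorm v < quot_rnorm q + e / 2.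
  by apply: quot_rnorm_lt; rewrite ltrDl.
rewrite -cosetD (le_trans (quot_rnorm_le _))// (le_trans (rnormD _ _))//.
by rewrite [e in leRHS]splitr addrACA lerD// ltW.
Qed.

Let quot_rnormZ_le (l : Cplx R) q :
  quot_rnorm (l *: q) <= complex.Re (`|l| : R[i]) * quot_rnorm q.
Proof.
set c := complex.Re _.
have c0 : 0 <= c.
  have: 0 <= `|l| by exact: normr_ge0.
  by rewrite /c; case: (`|l|) => a b; rewrite /Order.le/= => /andP[].
apply/ler_addgt0Pr => e e0.
have d0 : 0 < e / (c + 1) by rewrite divr_gt0// ltr_wpDl.
have [u <- ue] :
    exists2 u, coset W u = q & rnorm u < quot_rnorm q + e / (c + 1).
  by apply: quot_rnorm_lt; rewrite ltrDl.
rewrite -cosetZ (le_trans (quot_rnorm_le _))// rnormZ -/c.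
rewrite (le_trans (ler_wpM2l c0 (ltW ue)))// mulrDr lerD//.
by rewrite mulrCA ler_piMr ?(ltW e0)// ler_pdivrMr ?mul1r ?lerDl// ltr_wpDl.
Qed.

Definition quot_norm q : Cplx R := (quot_rnorm q)%:C%C.

Let quot_normD p q : quot_norm (p + q) <= quot_norm p + quot_norm q.
Proof. by rewrite addCplxR lecR_Cplx quot_rnormD. Qed.

Let quot_normZ (l : Cplx R) q : quot_norm (l *: q) = `|l| * quot_norm q.
Proof.
have le_norm (k : Cplx R) p : quot_norm (k *: p) <= `|k| * quot_norm p.
  have: 0 <= `|k| by exact: normr_ge0.
  have := quot_rnormZ_le k p; case: (`|k|) => a b /= kp.
  rewrite {1}/Order.le/= => /andP[/eqP -> _].
  change (quot_norm (k *: p) <= (a%:C%C : Cplx R) * quot_norm p).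
  by rewrite mulCplxR lecR_Cplx.
apply/eqP; rewrite eq_le le_norm/=.
have [->|l0] := eqVneq l 0.
  by rewrite normr0 mul0r (lecR_Cplx 0) quot_rnorm_ge0.
rewrite -ler_pdivlMl ?normr_gt0// -normfV.
by apply: le_trans (le_norm _ _); rewrite scalerA mulVf// scale1r.
Qed.

Let quot_norm_eq0 q : quot_norm q = 0 -> q = 0.
Proof.
move=> [q0]; elim/coset_ind: q q0 => v v0.
rewrite -coset0; apply/cosetP; rewrite subr0.
apply: (@cs_closed _ _ W) => A /nbhs_rnormP[e e0 eA].
have [|w wv we] := @quot_rnorm_lt (coset W v) e; first by rewrite v0.
exists (v - w); split; first exact/cosetP.
by apply: eA => /=; rewrite opprB addrC subrK.
Qed.

HB.instance Definition _ := Lmodule_isNormed.Build (Cplx R) Q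
  quot_normD quot_normZ quot_norm_eq0.

Lemma rnorm_coset_le v : rnorm (coset W v) <= rnorm v.
Proof. exact: quot_rnorm_le. Qed.

Lemma rnorm_coset_lt q e : rnorm q < e ->
  exists2 v, coset W v = q & rnorm v < e.
Proof. exact: quot_rnorm_lt. Qed.

Let quot_cauchy_cvg (F : set_system Q) : ProperFilter F -> cauchy F -> cvg F.
Proof.
move=> PF /cauchy_rnormP cF.
pose e n : R := 2^-1 ^+ n.
have e_gt0 n : 0 < e n by rewrite exprn_gt0// invr_gt0.
have eS n : e n = e n.+1 + e n.+1 by rewrite [LHS]splitr /e exprSr.
have e_lt n : e n.+1 < e n by rewrite [ltRHS]eS ltrDl.
have e_small d : 0 < d -> \forall n \near \oo, e n < d.
  move=> d0; have := near_infty_natSinv_expn_lt (PosNum d0).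
  by apply: filterS => n /=; rewrite /e exprVn div1r.
have [q Fq] := choice (fun n => cF (e n.+1) (e_gt0 _)).
have qS n : rnorm (q n - q n.+1) < e n.
  have [w [/= w1 w2]] := filter_ex (filterI (Fq n) (Fq n.+1)).
  rewrite (_ : q n - _ = (q n - w) - (q n.+1 - w)); last first.
    by rewrite opprB addrA subrK.
  rewrite (le_lt_trans (rnormD _ _))// rnormN eS ltrD//.
  by rewrite (lt_trans w2).
have lift n (v : {v | coset W v = q n}) :
    {v' : {v | coset W v = q n.+1} | rnorm (sval v - sval v') < e n}.
  apply: cid; case: v => v vq /=; have [w wq we] := rnorm_coset_lt (qS n).
  have wq' : coset W (v - w) = q n.+1.
    by rewrite cosetB vq wq opprB addrC subrK.
  exists (exist (fun u => coset W u = q n.+1) _ wq') => /=.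
  by rewrite opprB addrC subrK.
have v0 : {v | coset W v = q 0%N}.
  by exists (repr (q 0%N)); rewrite /coset reprK.
pose v := fix v n : {v | coset W v = q n} :=
  if n is m.+1 then sval (lift m (v m)) else v0.
pose s n := sval (v n).
have sS n : rnorm (s n - s n.+1) < e n by exact: svalP (lift n (v n)).
have sD n k : rnorm (s n.+1 - s (n.+1 + k)%N) <= e n - e (n + k)%N.
  elim: k => [|k IH]; first by rewrite !addn0 !subrr rnorm0.
  rewrite (_ : s n.+1 - _ = (s n.+1 - s (n.+1 + k)%N) +
                            (s (n.+1 + k)%N - s (n.+1 + k).+1)); last first.
    by rewrite addnS addrA subrK.
  rewrite (le_trans (rnormD _ _))// (le_trans (lerD IH (ltW (sS _))))//.
  by rewrite addnS addSn [e (n + k)%N]eS opprD addrA subrK.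
have scvg : cauchy (s @ \oo).
  apply/cauchy_rnormP => d d0.
  have [n _ /(_ n (leqnn n)) nd] := e_small _ d0.
  exists (s n.+1); exists n.+1 => // m /= nm.
  rewrite -(subnKC nm) (le_lt_trans (sD _ _))//.
  by rewrite (lt_trans _ nd)// ltrBlDr ltrDl.
have {}scvg := @cauchy_cvg _ (s @ \oo) _ scvg.
set l := lim (s @ \oo) in scvg.
apply/cvg_ex; exists (coset W l) => A /nbhs_rnormP[d d0 dA].
have d20 : 0 < d / 2 by rewrite divr_gt0.
have /scvg ls : nbhs l [set v | rnorm (l - v) < d / 2].
  by apply/nbhs_rnormP; exists (d / 2).
have {}ls : \oo [set n | rnorm (l - s n) < d / 2] by exact: ls.
have [n [/= nl nd]] := filter_ex (@filterI _ \oo _ _ _ ls (e_small _ d20)).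
apply: filterS (Fq n) => w /= wn; apply: dA => /=.
rewrite (_ : _ - w = coset W (l - s n) + (q n - w)); last first.
  by rewrite cosetB (svalP (v n)) addrA subrK.
rewrite (le_lt_trans (rnormD _ _))// [d]splitr ltrD//.
  exact: le_lt_trans (rnorm_coset_le _) nl.
by rewrite (lt_trans wn)// (lt_trans _ nd).
Qed.

HB.instance Definition _ := Uniform_isComplete.Build Q quot_cauchy_cvg.

End QuotientBanach.

(* The total space of a family of spaces is its disjoint union as a set. A
   record is used rather than {x : X & V x}, whose canonical topology is the
   disjoint union topology. *)
Record total (X : Type) (V : X -> Type) := Total { base : X; vec : V base }.
Arguments Total {X V} base vec.

Section TotalChoice.
Variables (X : choiceType) (V : X -> choiceType).

Let total_sigT (s : total V) : {x : X & V x} := existT _ (base s) (vec s).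
Let sigT_total (s : {x : X & V x}) : total V := Total (projT1 s) (projT2 s).
Let total_sigTK : cancel total_sigT sigT_total. Proof. by case. Qed.

HB.instance Definition _ := Choice.copy (total V) (can_type total_sigTK).
End TotalChoice.

(* A family of Banach spaces together with an arbitrary topology, given by its
   open sets, on the total space; the bundle axioms are [H_bundle] below. *)
Record bundle_data (R : realType) (X : topologicalType) := BundleData {
  fiber :> X -> completeNormedModType (Cplx R);
  bopen : set_system (total fiber);
  bopenT : bopen setT;
  bopenI : setI_closed bopen;
  bopen_bigU : forall (I : Type) (f : I -> set (total fiber)),
    (forall i, bopen (f i)) -> bopen (\bigcup_i f i) }.

Definition tot R X (B : @bundle_data R X) : Type := total (fiber B).

HB.instance Definition _ R X (B : @bundle_data R X) := Choice.on (tot B).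
HB.instance Definition _ R X (B : @bundle_data R X) :=
  isOpenTopological.Build (tot B)
    (@bopenT _ _ B) (@bopenI _ _ B) (@bopen_bigU _ _ B).

Section BundleOperations.
Context {R : realType} {X : topologicalType} (B : bundle_data R X).

Definition bproj (s : tot B) : X := base s.
Definition bzero (x : X) : tot B := Total x (0 : B x).
Definition bnorm (s : tot B) : R := rnorm (vec s).
Definition bscale (p : Cplx R * tot B) : tot B :=
  Total (base p.2) (p.1 *: vec p.2).

(* The fibre product of [tot B] with itself over X, with the topology induced by
   the inclusion [bpair] into [tot B * tot B]. *)
Definition bpair (p : total (fun x => (B x * B x)%type)) : tot B * tot B :=
  (Total (base p) (vec p).1, Total (base p) (vec p).2).
Definition fiber_product : topologicalType := initial_topology bpair.
Definition badd (p : fiber_product) : tot B :=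
  Total (base p) ((vec p).1 + (vec p).2).

End BundleOperations.

Definition open_map (S T : topologicalType) (f : S -> T) :=
  forall U : set S, open U -> open (f @` U).

Definition upper_semicontinuous (R : realType) (T : topologicalType)
    (f : T -> R) :=
  forall t (a : R), f t < a -> \forall t' \near t, f t' < a.

Record H_bundle (R : realType) (X : topologicalType)
    (B : bundle_data R X) : Prop := {
  H_proj_continuous : continuous (@bproj R X B);
  H_proj_open : open_map (@bproj R X B);
  H_proj_surj : range (@bproj R X B) = setT;
  H_scale_continuous : continuous (@bscale R X B);
  H_add_continuous : continuous (@badd R X B);
  H_norm_usc : upper_semicontinuous (@bnorm R X B);
  H_nbhs_zero : forall (x : X) (A : set (tot B)), nbhs (bzero B x) A <->
    exists (U : set X) (e : R), [/\ nbhs x U, 0 < e &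
      [set s | U (bproj s) /\ bnorm s < e] `<=` A] }.

Definition F_bundle (R : realType) (X : topologicalType)
    (B : bundle_data R X) : Prop :=
  H_bundle B /\ continuous (@bnorm R X B).

Section SubQuotient.
Context {R : realType} {X : topologicalType} (E : bundle_data R X).
Variable F : forall x, closed_subspace (E x).

(* The sub- and quotient bundles: the former has the topology induced by the
   inclusion in [tot E], the latter the quotient topology of [quot_map]. *)
Definition sub_incl (s : total (fun x => subsp (F x))) : tot E :=
  Total (base s) (val (vec s)).

Let sub_open : set_system (total (fun x => subsp (F x))) :=
  [set sub_incl @^-1` U | U in open].

Let sub_openT : sub_open setT.
Proof. exact: (@openT (initial_topology sub_incl)). Qed.

Let sub_openI : setI_closed sub_open.
Proof. exact: (@openI (initial_topology sub_incl)). Qed.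

Let sub_open_bigU (I : Type) (f : I -> set (total (fun x => subsp (F x)))) :
  (forall i, sub_open (f i)) -> sub_open (\bigcup_i f i).
Proof.
move=> oF; apply: (@bigcup_open (initial_topology sub_incl)) => i _.
exact: oF.
Qed.

Definition sub_bundle : bundle_data R X :=
  @BundleData R X (fun x => subsp (F x)) sub_open
    sub_openT sub_openI sub_open_bigU.

Definition quot_map (s : tot E) : total (fun x => quotsp (F x)) :=
  Total (base s) (coset (F (base s)) (vec s)).

Let quot_open : set_system (total (fun x => quotsp (F x))) :=
  [set V | open (quot_map @^-1` V)].

Let quot_openT : quot_open setT.
Proof. exact: openT. Qed.

Let quot_openI : setI_closed quot_open.
Proof. by move=> U V oU oV; exact: (@openI (tot E)). Qed.

Let quot_open_bigU (I : Type) (f : I -> set (total (fun x => quotsp (F x)))) :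
  (forall i, quot_open (f i)) -> quot_open (\bigcup_i f i).
Proof.
move=> oF; rewrite /quot_open/= preimage_bigcup.
by apply: (@bigcup_open (tot E)) => i _; exact: oF.
Qed.

Definition quot_bundle : bundle_data R X :=
  @BundleData R X (fun x => quotsp (F x)) quot_open
    quot_openT quot_openI quot_open_bigU.

End SubQuotient.

Definition upper_vietoris (Z : topologicalType) (C : set (set Z)) : Type :=
  set_type C.

HB.instance Definition _ (Z : topologicalType) (C : set (set Z)) :=
  Choice.on (upper_vietoris C).
HB.instance Definition _ (Z : topologicalType) (C : set (set Z)) :=
  isSubBaseTopological.Build (upper_vietoris C) (@open Z)
    (fun W => [set A : upper_vietoris C | set_val A `<=` W]).

Definition Cl (Z : topologicalType) :=
  upper_vietoris [set A : set Z | closed A].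

(* [fiber_ball r x] is the closed ball of radius r of F x, as a subset of
   [tot E]; that it is closed there uses the bundle axioms for E. *)
Section FiberBall.
Context {R : realType} {X : topologicalType} (E : bundle_data R X).
Variable F : forall x, closed_subspace (E x).

Definition fiber_ball (r : R) (x : X) : set (tot E) :=
  [set Total x v | v in [set v : E x | v \in F x /\ rnorm v <= r]].

Hypotheses (hX : hausdorff_space X) (hE : F_bundle E).

Lemma closed_fiber_ball (r : R) (x : X) : closed (fiber_ball r x).
Proof.
have [[proj_cont _ _ _ add_cont _ nbhs0] norm_cont] := hE.
have add_near (v : E x) (e : R) : 0 < e -> exists2 A : set (tot E),
    nbhs (Total x v : tot E) A &
    forall w : E x, A (Total x w : tot E) -> rnorm (v - w) < e.
  move=> e0; pose p : fiber_product E := Total x (v, - v).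
  have pe : nbhs (badd p) [set s : tot E | bnorm s < e].
    rewrite /badd/= subrr; apply/nbhs0.
    by exists setT, e; split => //; [exact: filterT|move=> ? []].
  have [_ [[G oG <-] Gp Ge]] := add_cont p _ pe.
  have [[A1 A2] [/= nA1 nA2] AG] : nbhs (bpair p) G by exact: open_nbhs_nbhs.
  exists A1 => // w A1w; rewrite rnormB.
  apply: (Ge (Total x (w, - v))); apply: AG; split => //=.
  exact: nbhs_singleton nA2.
move=> s s_cl.
have sx : base s = x.
  have cx : closed (@bproj R X E @^-1` [set x]).
    apply: preimage_closed => [? _|]; first exact: proj_cont.
    by apply: accessible_closed_set1; exact: hausdorff_accessible.
  by apply: cx; apply: closureS s_cl => _ [v _ <-].
have sr : bnorm s <= r.
  have cr : closed (@bnorm R X E @^-1` [set y | y <= r]).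
    apply: preimage_closed => [? _|]; [exact: norm_cont|exact: closed_le].
  by apply: cr; apply: closureS s_cl => _ [v [_ vr] <-].
case: s sx sr s_cl => y v /= yx; subst y; move=> vr s_cl.
exists v => //; split => //.
apply: (@cs_closed _ _ (F x)) => A /nbhs_rnormP[e e0 eA].
have [B vB Be] := add_near v e e0.
have [_ [[w [Fw _] <-] Bw]] := s_cl B vB.
by exists w; split => //; apply: eA; exact: Be.
Qed.

Definition fiber_ball_map (r : R) (x : X) : Cl (tot E) :=
  exist _ (fiber_ball r x) (mem_set (@closed_fiber_ball r x)).

End FiberBall.

(* Main.v *)
(* Multiplication by r'/r is a homeomorphism of E that preserves F, so all radii
   are equivalent. The quotient map q is open because the projection of F is, so
   E/F is an (H) bundle and only the lower semicontinuity of its norm is left.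
   Let a < |q u| and let N be an open neighbourhood of u, of fiberwise diameter
   less than a small e. The set W of those f for which some b in N over the same
   base point satisfies |b - f| > a + 2e is open and contains every ball of F_x.
   By upper Vietoris continuity it contains the balls of F_y of a large radius
   for y near x, so |v - f| > a + e for v in N near u and all such f; vectors f
   outside these balls are too far from v to matter. The set W replaces a
   continuous section through u. *)
Require Import Defs.
From HB Require Import structures.
From mathcomp Require Import all_boot all_order all_algebra.
From mathcomp Require Import finmap.
From mathcomp Require Import generic_quotient ring_quotient complex.
From mathcomp Require Import all_classical all_reals all_analysis.
From mathcomp Require Import lra.
Import Order.TTheory GRing.Theory Num.Theory.
Import numFieldNormedType.Exports.
Set Implicit Arguments.
Unset Strict Implicit.
Unset Printing Implicit Defensive.
Local Open Scope classical_set_scope.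
Local Open Scope ring_scope.

(** * Continuity into the upper Vietoris topology *)

Lemma upper_vietoris_cvgP (T Z : topologicalType) (C : set (set Z))
    (f : T -> upper_vietoris C) (t : T) :
  {for t, continuous f} <->
  forall W : set Z, open W -> set_val (f t) `<=` W ->
    \forall u \near t, set_val (f u) `<=` W.
Proof.
split=> [cf W oW fW|fP A].
  apply: (cf [set A : upper_vietoris C | set_val A `<=` W]).
  apply: open_nbhs_nbhs; split=> //.
  exists [set [set A : upper_vietoris C | set_val A `<=` W]].
    by move=> _ ->; exact: finI_from1.
  by rewrite bigcup_set1.
(* A neighbourhood of [f t] contains a finite intersection of subbasic sets around it, so checking
   each subbasic set is enough. *)
rewrite nbhsE => -[_ [[D' sD <-] [B D'B Bft]] DA].
have [G sG GB] := sD B D'B; subst B.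
have : (f @ t) (\bigcap_(W in [set` G])
    [set A : upper_vietoris C | set_val A `<=` W]).
  apply: filter_bigI => W GW; apply: fP; last exact: Bft.
  by move/sG: GW; rewrite inE.
by apply: filterS => K GK; apply: DA; exists (\bigcap_(W in [set` G])
    [set A : upper_vietoris C | set_val A `<=` W]).
Qed.

(** Transport along [base s = x], decided classically, extracts the vector over [x]; by proof
    irrelevance it is the identity on [Total x v]. *)
Lemma Total_inj (X : Type) (V : X -> Type) (x : X) :
  injective (@Total X V x).
Proof.
move=> u v /(congr1 (fun s : Defs.total V => if pselect (base s = x) is left e
  then eq_rect _ V (vec s) _ e else u)) /=.
by case: pselect => // e; rewrite (Prop_irrelevance e erefl).
Qed.

(** * Neighbourhoods and the fiberwise operations *)

Section FiberwiseOperations.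
Context {R : realType} {X : topologicalType} (E : bundle_data R X).
Hypothesis hE : H_bundle E.

(** The fibre product has the initial topology of [bpair], so each of its neighbourhoods contains
    the trace of a box. *)
Lemma nbhs_badd (x : X) (u v : E x) (A : set (tot E)) :
  nbhs (Total x (u + v) : tot E) A ->
  exists U V : set (tot E), [/\ nbhs (Total x u : tot E) U,
    nbhs (Total x v : tot E) V &
    forall y (a b : E y), U (Total y a) -> V (Total y b) ->
      A (Total y (a + b))].
Proof.
move=> uvA; pose p : fiber_product E := Total x (u, v).
have [_ [[G oG <-] Gp GA]] := H_add_continuous hE (x := p) uvA.
have [[U V] [/= nU nV] UVG] : nbhs (bpair p) G by exact: open_nbhs_nbhs.
exists U, V; split=> // y a b Ua Vb.
by apply: (GA (Total y (a, b))); exact: UVG.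
Qed.

Lemma nbhs_bscale (c : Cplx R) (x : X) (u : E x) (A : set (tot E)) :
  nbhs (Total x (c *: u) : tot E) A ->
  nbhs (Total x u : tot E) [set s : tot E | A (Total (base s) (c *: vec s))].
Proof.
move=> cuA.
have [[N V] [/= nN nV] NVA] :=
  H_scale_continuous hE (x := (c, Total x u : tot E)) cuA.
apply: filterS nV => s Vs; apply: (NVA (c, s)); split=> //.
exact: (@nbhs_singleton (Cplx R) c N nN).
Qed.

Lemma nbhs_bsub (x : X) (u v : E x) (A : set (tot E)) :
  nbhs (Total x (u - v) : tot E) A ->
  exists U V : set (tot E), [/\ nbhs (Total x u : tot E) U,
    nbhs (Total x v : tot E) V &
    forall y (a b : E y), U (Total y a) -> V (Total y b) ->
      A (Total y (a - b))].
Proof.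
move=> /nbhs_badd[U [V [nU nV UVA]]].
exists U, [set s : tot E | V (Total (base s) (- vec s))]; split=> //.
  have := @nbhs_bscale (-1) x v V; rewrite scaleN1r => /(_ nV).
  by apply: filterS => s /=; rewrite scaleN1r.
by move=> y a b Ua Vb; exact: UVA.
Qed.

Lemma nbhs_bproj (s : tot E) (A : set (tot E)) :
  nbhs s A -> nbhs (bproj s) (@bproj R X E @` A).
Proof.
rewrite !nbhsE => -[B [oB Bs] BA]; exists (@bproj R X E @` B).
  by split; [exact: (H_proj_open hE)|exists s].
exact: image_subset.
Qed.

End FiberwiseOperations.

(** * The quotient map is open and the quotient is an (H) bundle *)

Section Quotient.
Context {R : realType} {X : topologicalType} (E : bundle_data R X).
Variable F : forall x, closed_subspace (E x).
Hypotheses (hE : H_bundle E) (hF : H_bundle (sub_bundle F)).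
Local Notation Q := (quot_bundle F).
Local Notation q := (quot_map F : tot E -> tot Q).

Lemma quot_map_continuous : continuous q.
Proof. by apply/continuousP => A oA; exact: oA. Qed.

Lemma quot_map_surj (p : tot Q) : exists s, q s = p.
Proof.
case: p => x; apply: (@coset_ind R (E x) (F x)) => v.
by exists (Total x v).
Qed.

Lemma quot_mapP (s : tot E) (x : X) (p : Q x) :
  q s = Total x p -> exists2 u : E x, s = Total x u & coset (F x) u = p.
Proof.
case: s => y u e; have yx : y = x := congr1 (@base _ _) e.
by subst y; exists u => //; exact: (Total_inj e).
Qed.

(* The saturation of [U] is [U + F]. It is open: if [t] is near [u + f], then
   openness of the projection of F provides [g] near [f] in the fiber of [t],
   and [t - g] is near [u]. *)
Lemma quot_map_open : open_map q.
Proof.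
move=> U oU; change (open (q @^-1` (q @` U))).
rewrite openE => -[x v] [s Us /quot_mapP[u su]]; subst s.
move=> /esym/cosetP uvF.
have : nbhs (Total x (v - (v - u)) : tot E) U.
  by rewrite subKr; exact: open_nbhs_nbhs.
move=> /(nbhs_bsub hE)[A [B [nA nB ABU]]].
pose f : tot (sub_bundle F) := Total x (exist _ (v - u) uvF).
have nBF : nbhs f (@sub_incl _ _ _ F @^-1` B).
  exact: (@initial_continuous _ _ (@sub_incl _ _ _ F) f).
have nP := H_proj_continuous hE (x := Total x v) (nbhs_bproj hF nBF).
apply: filterS (filterI nA nP) => -[y a] [Aa [[z [g Fg]] /= Bg gy]].
rewrite /bproj/= in gy; subst z.
exists (Total y (a - g)); first exact: ABU.
congr Total; apply/cosetP.
by rewrite addrAC subrr add0r rpredN.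
Qed.

Lemma nbhs_quot_map (s : tot E) (A : set (tot E)) :
  nbhs s A -> nbhs (q s) (q @` A).
Proof.
rewrite !nbhsE => -[B [oB Bs] BA]; exists (q @` B).
  by split; [exact: quot_map_open|exists s].
exact: image_subset.
Qed.

(** The axioms descend from [E] because [q] is a continuous open surjection and a class of norm
    below [e] has a representative of norm below [e]. *)
Lemma H_bundle_quot : H_bundle Q.
Proof.
split.
- apply/continuousP => A oA.
  change (open (q @^-1` (@bproj R X Q @^-1` A))).
  by have /continuousP := H_proj_continuous hE; exact.
- move=> U oU.
  rewrite (_ : _ @` _ = @bproj R X E @` (q @^-1` U)).
    exact: H_proj_open.
  rewrite seteqP; split=> [_ [p Up <-]|_ [s Us <-]]; last by exists (q s).
  by have [s sp] := quot_map_surj p; exists s; rewrite -?sp// /= sp.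
- rewrite seteqP; split=> // x _.
  have : range (@bproj R X E) x by rewrite (H_proj_surj hE).
  by move=> [s _ <-]; exists (q s).
- move=> [c p]; have [s <-{p}] := quot_map_surj p => V nV.
  have : nbhs (q (bscale (c, s))) V.
    by move: nV; rewrite /bscale/= -cosetZ.
  move=> /quot_map_continuous/(H_scale_continuous hE (x := (c, s))).
  move=> [[N A] [/= nN nA] NAV].
  exists (N, q @` A); first by split=> //; exact: nbhs_quot_map.
  move=> [d _] [/= Nd [t At <-]].
  by have := NAV (d, t) (conj Nd At); rewrite /bscale/= -cosetZ.
- move=> [x [c d]] V; rewrite /badd/=.
  elim/(@coset_ind R (E x) (F x)): c => u.
  elim/(@coset_ind R (E x) (F x)): d => v; rewrite -cosetD => nV.
  have [A [B [nA nB ABV]]] :=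
    nbhs_badd hE (quot_map_continuous (x := Total x (u + v)) nV).
  pose p : fiber_product Q := Total x (coset (F x) u, coset (F x) v).
  have np : nbhs p (@bpair _ _ Q @^-1` (q @` A `*` q @` B)).
    apply: (@initial_continuous _ _ (@bpair _ _ Q) p).
    by exists (q @` A, q @` B) => //; split; [exact: (nbhs_quot_map nA)|
      exact: (nbhs_quot_map nB)].
  apply: filterS np => -[y [c d]] [/= [s As /quot_mapP[a sa <-]]].
  move=> [t Bt /quot_mapP[b tb <-]]; subst s t.
  by rewrite /badd/= -cosetD; exact: ABV.
- move=> p a; have [[x v] <-{p}] := quot_map_surj p => /rnorm_coset_lt[w wv wa].
  (* Semicontinuity is used at the representative [w], as [v] itself may have norm at least [a]. *)
  have := @nbhs_quot_map (Total x w) _ 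
    (H_norm_usc hE (t := Total x w) wa).
  rewrite /= /quot_map/= wv; apply: filterS => _ [s sa <-].
  exact: le_lt_trans (rnorm_coset_le _ _) sa.
- move=> x A; have q0 : bzero Q x = q (bzero E x) by rewrite /quot_map/= coset0.
  split=> [|[U [e [nU e0 UA]]]].
    rewrite q0 => /quot_map_continuous/(H_nbhs_zero hE)[U [e [nU e0 UA]]].
    exists U, e; split=> // -[y c] [Uy /rnorm_coset_lt[v]].
    rewrite /= => <- ve.
    exact: (UA (Total y v)).
  rewrite q0; have : nbhs (bzero E x) [set s | U (bproj s) /\ bnorm s < e].
    by apply/(H_nbhs_zero hE); exists U, e; split.
  move=> /nbhs_quot_map; apply: filterS => _ [s [Us se] <-]; apply: UA.
  by split=> //; exact: le_lt_trans (rnorm_coset_le _ _) se.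
Qed.

End Quotient.

(** * Continuity of the ball map and lower semicontinuity of the quotient norm *)

Section FiberBallContinuity.
Context {R : realType} {X : topologicalType} (E : bundle_data R X).
Variable F : forall x, closed_subspace (E x).
Hypotheses (hE : F_bundle E) (hF : H_bundle (sub_bundle F)).
Local Notation Q := (quot_bundle F).
Local Notation q := (quot_map F : tot E -> tot Q).

Definition fiber_ball_usc (r : R) := forall (x : X) (W : set (tot E)),
  open W -> fiber_ball F r x `<=` W ->
  \forall y \near x, fiber_ball F r y `<=` W.

Lemma fiber_ball_mapP (hX : hausdorff_space X) (r : R) :
  continuous (fiber_ball_map F hX hE r) <-> fiber_ball_usc r.
Proof.
split=> [cr x W oW|ur x]; last by apply/upper_vietoris_cvgP => W; exact: ur.
by have /upper_vietoris_cvgP := cr x; exact.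
Qed.

Lemma fiber_ball_uscZ (r r' : R) : 0 < r -> 0 < r' ->
  fiber_ball_usc r -> fiber_ball_usc r'.
Proof.
have scale_ball (c s : R) x v : 0 < c ->
    fiber_ball F s x (Total x v) ->
    fiber_ball F (c * s) x (Total x (c%:C%C *: v)).
  move=> c0 [w [Fw ws] wv]; rewrite -(Total_inj wv); exists (c%:C%C *: w) => //; split.
    exact: rpredZ.
  by rewrite rnormZ normCplxR ?(ltW c0)//= ler_pM2l.
move=> r0 r'0 ur x W oW xW.
pose c := r' / r.
have c0 : 0 < c by rewrite divr_gt0.
pose m (k : R) (s : tot E) : tot E := Total (base s) (k%:C%C *: vec s).
have mK k s : 0 < k -> m k (m k^-1 s) = s.
  case: s => y v k0; rewrite /m/= scalerA.
  by rewrite (mulCplxR k k^-1) divff ?gt_eqF// scale1r.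
have oW' : open (m c @^-1` W).
  rewrite openE => -[y v] Wv; apply: (nbhs_bscale hE.1).
  exact: open_nbhs_nbhs.
have xW' : fiber_ball F r x `<=` m c @^-1` W.
  move=> _ [v Fv <-]; apply: xW; rewrite -[r'](divfK (lt0r_neq0 r0)).
  by apply: scale_ball => //; exists v.
apply: filterS (ur x _ oW' xW') => y yW _ [v Fv <-].
(* A vector of the ball of radius [r'] is [m c] of one in the ball of radius [r], which lies in the
   preimage of [W]. *)
rewrite -(mK c (Total y v))//; apply: yW.
have -> : r = c^-1 * r' by rewrite /c invf_div divfK// gt_eqF.
by apply: scale_ball; rewrite ?invr_gt0//; exists v.
Qed.

Lemma quot_norm_lsc (t : tot Q) (a : R) :
  (forall r, 0 < r -> fiber_ball_usc r) -> a < bnorm t ->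
  \forall t' \near t, a < bnorm t'.
Proof.
move=> uF; have [[x u] <-{t}] := quot_map_surj t.
(* Then [a + 2e = n - e < n]; one [e] pays for the diameter of [N], the other for the choice of a
   representative below. *)
set n := bnorm _ => an; pose e := (n - a) / 3.
have e0 : 0 < e by rewrite divr_gt0// subr_gt0.
have en : a + e + e < n by rewrite /e; lra.
have n0 : 0 <= n := rnorm_ge0 _.
have : nbhs (Total x (u - u) : tot E) [set s | bnorm s < e].
  rewrite subrr; apply/(H_nbhs_zero hE.1).
  by exists setT, e; split=> //; [exact: filterT|move=> ? []].
move=> /(nbhs_bsub hE.1)[A [B [nA nB ABe]]].
(* The interior makes [N] a neighbourhood of each of its points, as the openness of [W] requires. *)
pose N := (A `&` B)^°.
have Ne y (b c : E y) : N (Total y b) -> N (Total y c) -> rnorm (b - c) < e.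
  by move=> /interior_subset[Ab _] /interior_subset[_ Bc]; exact: ABe.
have nN : nbhs (Total x u : tot E) N by apply: nbhs_interior; exact: filterI.
pose W := [set f : tot E | exists2 b : E (base f),
  N (Total (base f) b) & a + e + e < rnorm (b - vec f)].
have oW : open W.
  rewrite openE => -[y f] [b /= Nb bf].
  have : nbhs (Total y (b - f) : tot E) [set s | a + e + e < bnorm s].
    exact: cvgr_gt (hE.2 (Total y (b - f))) _ bf.
  move=> /(nbhs_bsub hE.1)[C [D [nC nD CDW]]].
  have nCN : nbhs (Total y b : tot E) (C `&` N).
    apply: filterI => //; apply: open_nbhs_nbhs; split=> //.
    exact: open_interior.
  (* Since the projection is open, over every base point near [y] some [c] in both [C] and [N] can
     take the place of [b]. *)
  have nP := H_proj_continuous hE.1 (x := Total y f) (nbhs_bproj hE.1 nCN).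
  apply: filterS (filterI nD nP) => -[z g] [Dg [[z' c] [Cc Nc] cz]].
  rewrite /bproj/= in cz; subst z'.
  by exists c => //; exact: CDW.
(* For [v] near [u] and [|w| < a + e < n], the vector [v - w] has norm at most [r]. *)
pose r := rnorm u + 1 + n.
have xW : fiber_ball F r x `<=` W.
  (* Here [b = u] works: [u - f] represents the class of [u], so its norm is at least [n]. *)
  move=> _ [f [Ff _] <-]; exists u; first exact: nbhs_singleton nN.
  apply: lt_le_trans en _; rewrite /n /bnorm /=.
  have -> : coset (F x) u = coset (F x) (u - f).
    by apply/cosetP; rewrite opprB addrC subrK.
  exact: rnorm_coset_le.
have r0 : 0 < r by rewrite /r; have := rnorm_ge0 u; lra.
have nW : \forall s \near (Total x u : tot E),
    fiber_ball F r (bproj s) `<=` W.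
  exact: (H_proj_continuous hE.1 (x := Total x u) (uF r r0 x W oW xW)).
have nu : \forall s \near (Total x u : tot E), bnorm s < rnorm u + 1.
  by apply: (H_norm_usc hE.1); rewrite /bnorm/= ltrDl.
have /(nbhs_quot_map hE.1 hF) :
    \forall s \near (Total x u : tot E), [/\ N s,
      fiber_ball F r (bproj s) `<=` W & bnorm s < rnorm u + 1].
  by apply: filterS3 nN nW nu.
apply: filterS => _ [[y v] [Nv yW vu] <-].
(* If the class of [v] had norm at most [a], a representative [w] with [|w| < a + e] would put
   [f = v - w] in the ball, and some [b] in [N] would satisfy [a + 2e < |b - f| <= |b - v| + |w| < a
   + 2e]. *)
rewrite ltNge; apply/negP => va.
have [|w wv we] := @rnorm_coset_lt _ _ (F y) (coset (F y) v) (a + e).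
  by apply: le_lt_trans va _; rewrite ltrDl.
have [|b /= Nb bw] := yW (Total y (v - w)).
  exists (v - w) => //; split; first by apply/cosetP.
  rewrite (le_trans (rnormD _ _))// rnormN /r lerD// ?(ltW vu)//.
  by apply: ltW; apply: lt_trans we _; lra.
have := Ne _ _ _ Nb Nv.
have : rnorm (b - (v - w)) <= rnorm (b - v) + rnorm w.
  by rewrite opprB addrCA addrC rnormD.
by lra.
Qed.

Lemma F_bundle_quot :
  (forall r, 0 < r -> fiber_ball_usc r) -> F_bundle Q.
Proof.
move=> uF; have hQ := H_bundle_quot hE.1 hF; split=> // t.
apply: (@cvgrPdist_lt _ _ _ (nbhs t) _ (bnorm (B := Q)) _).2 => e e0.
have usc : \forall t' \near t, bnorm t' < bnorm t + e.
  by apply: (H_norm_usc hQ); rewrite ltrDl.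
have lsc : \forall t' \near t, bnorm t - e < bnorm t'.
  by apply: quot_norm_lsc => //; rewrite ltrBlDr ltrDl.
apply: filterS2 usc lsc => t' t'u t'l.
by rewrite ltr_distlC t'l t'u.
Qed.

End FiberBallContinuity.

Theorem theorem2p8 (R : realType) (X : topologicalType)
    (E : bundle_data R X) (F : forall x : X, closed_subspace (E x))
    (cX : compact [set: X]) (hX : hausdorff_space X)
    (hE : F_bundle E) (hF : F_bundle (sub_bundle F)) :
  ((exists2 r : R, 0 < r & continuous (fiber_ball_map F hX hE r)) <->
   (forall r : R, 0 < r -> continuous (fiber_ball_map F hX hE r))) /\
  ((exists2 r : R, 0 < r & continuous (fiber_ball_map F hX hE r)) ->
   F_bundle (quot_bundle F)).
Proof.
have all_radii :
    (exists2 r : R, 0 < r & continuous (fiber_ball_map F hX hE r)) ->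
    forall r, 0 < r -> fiber_ball_usc F r.
  by move=> [r r0 /fiber_ball_mapP ur] r' r'0; exact: fiber_ball_uscZ r0 r'0 ur.
split; [split=> [/all_radii ur r r0|cr]|move=> /all_radii ur].
- by apply/fiber_ball_mapP; exact: ur.
- by exists 1 => //; exact: cr.
- exact: F_bundle_quot hE hF.1 ur.
Qed.
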